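(* Let $G$ be a finite group, $K$ a finite field, $\Theta\in\mathrm{Hom}(G,\mathrm{Aut}(K))$, and let $\alpha:G\times G\to K^*$ be a normalized $2$-cocycle of $G$ stabilized by $\Theta(G)$. If $\mathrm{char}\,K\nmid|G|$, then the twisted skew group ring $R=K[G,\Theta,\alpha]$ is a semisimple ring.
   Context: A normalized $2$-cocycle of $G$ is a map $\alpha:G\times G\to K^*$ with $\alpha(g,1)=\alpha(1,g)=1$ for all $g$ and $\alpha(g_1,g_2g_3)\alpha(g_2,g_3)=\alpha(g_1g_2,g_3)\alpha(g_1,g_2)$ for all $g_1,g_2,g_3\in G$. It is stabilized by $\Theta(G)$ if $\Theta(g)(\alpha(x,y))=\alpha(x,y)$ for all $g,x,y\in G$. The twisted skew group ring $K[G,\Theta,\alpha]$ is the left $K$-vector space with basis $\{\overline g\mid g\in G\}$ and multiplication $\sum_g a_g\overline g\cdot\sum_h b_h\overline h=\sum_{g,h}a_g(\Theta(g)b_h)\alpha(g,h)\overline{gh}$; it is an associative ring with identity $\overline1$. *)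

(* Defs.v *)
From HB Require Import structures.
From mathcomp Require Import all_boot all_order all_fingroup all_algebra.

Set Implicit Arguments.
Unset Strict Implicit.
Unset Printing Implicit Defensive.

Import GRing.Theory.
Local Open Scope ring_scope.

Section SemisimpleRing.

Variable R : pzRingType.

Definition simple_submodule (V : lmodType R) (S : {pred V}) : Prop :=
  [/\ GRing.submod_closed S,
      exists2 v, v \in S & v != 0
    & forall T : {pred V}, GRing.submod_closed T -> {subset T <= S} ->
        T =i pred1 0 \/ T =i S].

Definition is_direct_sum (V : lmodType R) (n : nat) (S : 'I_n -> {pred V}) :
    Prop :=
  forall v : V, exists! w : {ffun 'I_n -> V},
    (forall i, w i \in S i) /\ v = \sum_(i < n) w i.

(* The left regular module R^o, whose submodules are the left ideals of R, is *)
(* a direct sum of simple submodules.  As R^o is generated by 1, such a sum   *)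
(* is necessarily finite.                                                     *)
Definition semisimple_ring : Prop :=
  exists (n : nat) (S : 'I_n -> {pred R^o}),
    (forall i, simple_submodule (S i)) /\ is_direct_sum S.

End SemisimpleRing.

Section TwistedSkewGroupRing.

Variables (gT : finGroupType) (K : finFieldType).

Implicit Types (Theta : gT -> {rmorphism K -> K}) (alpha : gT -> gT -> {unit K}).

(* Theta is a group homomorphism from gT to Aut(K), the group law of Aut(K)   *)
(* being composition; Theta 1 = id follows by cancellation.                   *)
Definition hom_to_Aut Theta : Prop :=
  (forall g, bijective (Theta g)) /\
  (forall g h, Theta (g * h)%g =1 Theta g \o Theta h).

Definition normalized_cocycle alpha : Prop :=
  (forall g, alpha g 1%g = 1%g /\ alpha 1%g g = 1%g) /\
  (forall g1 g2 g3,
     alpha g1 (g2 * g3)%g * alpha g2 g3 = alpha (g1 * g2)%g g3 * alpha g1 g2)%g.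

Definition stabilized_by Theta alpha : Prop :=
  forall g x y, Theta g (val (alpha x y)) = val (alpha x y).

Section Construction.

Variables (Theta : gT -> {rmorphism K -> K}) (alpha : gT -> gT -> {unit K}).
Hypotheses (hTheta : hom_to_Aut Theta) (halpha : normalized_cocycle alpha).
Hypothesis (hstab : stabilized_by Theta alpha).

(* The element \sum_g a_g \bar{g} is represented by the function g |-> a_g.   *)
(* The three proofs are arguments of the type because the ring laws of its    *)
(* canonical ring structure depend on them.                                   *)
Definition twisted_skew_ring of hom_to_Aut Theta & normalized_cocycle alpha
    & stabilized_by Theta alpha : Type := {ffun gT -> K}.

Local Notation tsr := (twisted_skew_ring hTheta halpha hstab).

HB.instance Definition _ := Finite.copy tsr {ffun gT -> K}.
HB.instance Definition _ := GRing.Lmodule.copy tsr {ffun gT -> K^o}.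

Definition tsr_coef (a : tsr) (g : gT) : K := (a : {ffun gT -> K}) g.

Definition tsr_bar (g : gT) : tsr := [ffun x => (x == g)%:R].

Definition tsr_mul (a b : tsr) : tsr :=
  \sum_(g : gT) \sum_(h : gT)
    (tsr_coef a g * Theta g (tsr_coef b h) * val (alpha g h))
      *: tsr_bar (g * h)%g.

Lemma tsr_coefP (a b : tsr) : (forall g, tsr_coef a g = tsr_coef b g) -> a = b.
Proof. by move=> eq_ab; apply/ffunP. Qed.

Lemma tsr_coefD (a b : tsr) g : tsr_coef (a + b) g = tsr_coef a g + tsr_coef b g.
Proof. by rewrite /tsr_coef ffunE. Qed.

Lemma tsr_coefZ k (a : tsr) g : tsr_coef (k *: a) g = k * tsr_coef a g.
Proof. by rewrite /tsr_coef ffunE. Qed.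

Lemma tsr_coef_bar g x : tsr_coef (tsr_bar g) x = (x == g)%:R.
Proof. by rewrite /tsr_coef ffunE. Qed.

Lemma tsr_coef_sum (I : finType) (F : I -> tsr) g :
  tsr_coef (\sum_i F i) g = \sum_i tsr_coef (F i) g.
Proof. by rewrite /tsr_coef sum_ffunE. Qed.

Lemma tsr_expand (a : tsr) : a = \sum_g tsr_coef a g *: tsr_bar g.
Proof.
apply: tsr_coefP => x; rewrite tsr_coef_sum (bigD1 x) //= big1 ?addr0.
  by rewrite tsr_coefZ tsr_coef_bar eqxx mulr1.
by move=> g neq_gx; rewrite tsr_coefZ tsr_coef_bar eq_sym (negPf neq_gx) mulr0.
Qed.

Lemma tsr_coefM (a b : tsr) x :
  tsr_coef (tsr_mul a b) x =
  \sum_g tsr_coef a g * Theta g (tsr_coef b (g^-1 * x)%g)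
           * val (alpha g (g^-1 * x)%g).
Proof.
rewrite tsr_coef_sum; apply: eq_bigr => g _.
rewrite tsr_coef_sum (bigD1 (g^-1 * x)%g) //= big1 ?addr0.
  by rewrite tsr_coefZ tsr_coef_bar mulKVg eqxx mulr1.
move=> h neq_h; rewrite tsr_coefZ tsr_coef_bar.
case: eqP => [def_x | _]; last by rewrite mulr0.
by rewrite def_x mulKg eqxx in neq_h.
Qed.

Lemma hom_to_Aut1 : Theta 1%g =1 id.
Proof.
have [bijT homT] := hTheta => x.
by apply: (bij_inj (bijT 1%g)); have := homT 1%g 1%g x; rewrite /= mulg1.
Qed.

Fact tsr_mulA : associative tsr_mul.
Proof.
have [_ homT] := hTheta; have [_ cocA] := halpha.
move=> a b c; apply: tsr_coefP => x; rewrite !tsr_coefM.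
under [RHS]eq_bigr => k _ do rewrite tsr_coefM !mulr_suml.
rewrite exchange_big; apply: eq_bigr => g _ /=.
rewrite (reindex_inj (mulgI g)) /= tsr_coefM raddf_sum mulr_sumr mulr_suml.
apply: eq_bigr => h _ /=.
rewrite !rmorphM /= hstab mulKg invMg -!mulgA homT /=.
set y := (h^-1 * _)%g.
have := congr1 val (cocA g h y); rewrite /= mulKVg => def_al.
rewrite -!mulrA; congr (_ * (_ * _)); rewrite [RHS]mulrCA; congr (_ * _).
by rewrite mulrC def_al mulrC.
Qed.

Fact tsr_mul1l : left_id (tsr_bar 1%g) tsr_mul.
Proof.
have [normal _] := halpha; move=> a; apply: tsr_coefP => x.
rewrite tsr_coefM (bigD1 1%g) //= big1 ?addr0 => [|g neq_g].
  by rewrite tsr_coef_bar eqxx invg1 !mul1g hom_to_Aut1 (normal x).2 /= mul1r mulr1.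
by rewrite tsr_coef_bar (negPf neq_g) !mul0r.
Qed.

Fact tsr_mul1r : right_id (tsr_bar 1%g) tsr_mul.
Proof.
have [normal _] := halpha; move=> a; apply: tsr_coefP => x.
rewrite tsr_coefM (bigD1 x) //= big1 ?addr0 => [|g neq_g].
  by rewrite mulVg tsr_coef_bar eqxx rmorph1 (normal x).1 /= !mulr1.
rewrite tsr_coef_bar; case: eqP => [def_x | _]; last by rewrite rmorph0 mulr0 mul0r.
by rewrite -(mulKVg g x) def_x mulg1 eqxx in neq_g.
Qed.

Fact tsr_mulDl : left_distributive tsr_mul +%R.
Proof.
move=> a b c; apply: tsr_coefP => x; rewrite tsr_coefD !tsr_coefM -big_split.
by apply: eq_bigr => g _; rewrite tsr_coefD !mulrDl.
Qed.

Fact tsr_mulDr : right_distributive tsr_mul +%R.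
Proof.
move=> a b c; apply: tsr_coefP => x; rewrite tsr_coefD !tsr_coefM -big_split.
by apply: eq_bigr => g _; rewrite tsr_coefD rmorphD mulrDr mulrDl.
Qed.

Fact tsr_1neq0 : tsr_bar 1%g != 0.
Proof.
apply/eqP => /(congr1 (tsr_coef^~ 1%g)); rewrite tsr_coef_bar eqxx /tsr_coef ffunE.
by apply/eqP; apply: oner_neq0.
Qed.

HB.instance Definition _ := GRing.Zmodule_isNzRing.Build tsr
  tsr_mulA tsr_mul1l tsr_mul1r tsr_mulDl tsr_mulDr tsr_1neq0.

Fact tsr_scalerAl k (a b : tsr) : k *: (a * b) = (k *: a) * b.
Proof.
apply: tsr_coefP => x; rewrite tsr_coefZ !tsr_coefM mulr_sumr.
by apply: eq_bigr => g _; rewrite tsr_coefZ !mulrA.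
Qed.

HB.instance Definition _ :=
  GRing.LSemiModule_isLSemiAlgebra.Build K tsr tsr_scalerAl.

Lemma tsr_mulZbar k l g h :
  (k *: tsr_bar g) * (l *: tsr_bar h) =
  (k * Theta g l * val (alpha g h)) *: tsr_bar (g * h)%g.
Proof.
apply: tsr_coefP => x; rewrite tsr_coefM tsr_coefZ tsr_coef_bar (bigD1 g) //= big1.
  rewrite addr0 !tsr_coefZ !tsr_coef_bar eqxx mulr1.
  rewrite -(inj_eq (mulgI g)) mulKVg.
  by case: eqP => [->|_]; rewrite ?mulKg ?mulr1 // !mulr0 rmorph0 mulr0 mul0r.
by move=> f neq_f; rewrite tsr_coefZ tsr_coef_bar (negPf neq_f) mulr0 !mul0r.
Qed.

End Construction.

End TwistedSkewGroupRing.

(* Main.v *)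
(** Maschke's argument. If [pi] is a [K]-linear projection of [R] onto a left
    ideal [L], then [e = sum_g gbar^-1 * pi gbar] lies in [L] and satisfies
    [x * e = sum_g gbar^-1 * pi (gbar * x)] for every [x], hence
    [x * e = |G| x] on [L]. As [|G|] is invertible in [K], a multiple of [e]
    is a right identity for [L], so [L = R e] has the complement
    [{x | x * e = 0}]. The ring being finite, splitting off minimal left ideals
    one at a time decomposes it into simple ones. *)
Require Import Defs.
From mathcomp Require Import all_boot all_order all_fingroup all_algebra.

Set Implicit Arguments.
Unset Strict Implicit.
Unset Printing Implicit Defensive.

Import GRing.Theory.

(** * Finite rings in which every left ideal has a right identity *)

Section FiniteRing.
Local Open Scope ring_scope.

Variable R : finNzRingType.

(** Boolean and on finite sets, so that [minset] and induction on cardinality apply. *)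
Definition left_ideal (L : {set R}) : bool :=
  (0 \in L) && [forall a, forall u in L, forall v in L, a * u + v \in L].

Lemma left_idealP (L : {set R}) :
  reflect (0 \in L /\ forall a u v, u \in L -> v \in L -> a * u + v \in L)
          (left_ideal L).
Proof.
apply: (iffP andP) => -[L0 Llin]; split=> //.
  move=> a u v Lu Lv.
  by move/forallP/(_ a)/forall_inP/(_ u Lu)/forall_inP: Llin; apply.
apply/forallP => a; apply/forall_inP => u Lu; apply/forall_inP => v Lv.
exact: Llin.
Qed.

Lemma submod_closed_left_ideal (T : {pred R^o}) :
  GRing.submod_closed T -> left_ideal [set x : R | x \in T].
Proof.
move=> [T0 Tlin]; apply/left_idealP; split; first by rewrite inE.
by move=> a u v; rewrite !inE; apply: Tlin.
Qed.

Lemma left_ideal_submod_closed (L : {set R}) :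
  left_ideal L -> GRing.submod_closed ([in L] : {pred R^o}).
Proof. by case/left_idealP => L0 Llin; split=> // a u v; apply: Llin. Qed.

Lemma left_ideal_mul (L : {set R}) a x : left_ideal L -> x \in L -> a * x \in L.
Proof. by case/left_idealP=> L0 Llin Lx; rewrite -[a * x]addr0 Llin. Qed.

Lemma left_ideal_add (L : {set R}) x y :
  left_ideal L -> x \in L -> y \in L -> x + y \in L.
Proof. by case/left_idealP=> L0 Llin Lx Ly; rewrite -[x]mul1r Llin. Qed.

Lemma left_ideal_sum (L : {set R}) (I : finType) (F : I -> R) :
  left_ideal L -> (forall i, F i \in L) -> \sum_i F i \in L.
Proof.
move=> idL LF; elim/big_ind: _ => //; first by case/left_idealP: idL.
by move=> x y; apply: left_ideal_add.
Qed.

Lemma minimal_left_ideal_simple (S : {set R}) :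
    minset (fun A => left_ideal A && (A != [set 0])) S ->
  simple_submodule ([in S] : {pred R^o}).
Proof.
case/minsetP => /andP [idS neS0] minS.
have /left_idealP [S0 _] := idS.
split; first exact: left_ideal_submod_closed.
  apply/exists_inP; apply: contraR neS0 => /exists_inPn allS0.
  rewrite eqEsubset sub1set S0 andbT.
  by apply/subsetP => x /allS0; rewrite negbK inE.
move=> T clT sTS; have idT := submod_closed_left_ideal clT.
have [eqT0 | neT0] := eqVneq [set x : R | x \in T] [set 0].
  by left=> x; move/setP/(_ x): eqT0; rewrite !inE.
right=> x; have <- : [set x : R | x \in T] = S; last by rewrite !inE.
apply: minS; first by rewrite idT.
by apply/subsetP => y; rewrite inE => /sTS.
Qed.

Hypothesis right_identity : forall L : {set R}, left_ideal L ->
  exists2 e, e \in L & forall x, x \in L -> x * e = x.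

(** Stated for every left ideal so that induction on [#|L|] applies: if [e] is a right identity of a
    minimal [S0] inside [L], then [L] is the direct sum of [S0] and the kernel [L'] of right
    multiplication by [e] on [L]. *)
Lemma left_ideal_direct_sum (L : {set R}) : left_ideal L ->
  exists (n : nat) (S : 'I_n -> {pred R^o}),
    [/\ forall i, simple_submodule (S i),
        forall i, {subset S i <= L}
      & forall v : R^o, v \in L -> exists! w : {ffun 'I_n -> R^o},
          (forall i, w i \in S i) /\ v = \sum_(i < n) w i].
Proof.
have [m] := ubnP #|L|; elim: m L => // m IHm L leLm idL.
have /left_idealP [L0 _] := idL.
have [-> | neL0] := eqVneq L [set 0].
  (* The zero ideal is the empty direct sum. *)
  exists 0%N, (fun _ => pred0 : {pred R^o}); split=> [[] // | [] // | v].
  rewrite inE => /eqP ->; exists [ffun _ => 0]; split.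
    by split=> [[] // |]; rewrite big_ord0.
  by move=> w _; apply/ffunP => -[].
have [|S0 minS0 sS0L] :=
  @minset_exists _ (fun A => left_ideal A && (A != [set 0])) L.
  by rewrite idL.
have simpleS0 := minimal_left_ideal_simple minS0.
have /andP [idS0 _] := minsetp minS0.
have [e eS0 eK] := right_identity idS0.
pose L' := [set x in L | x * e == 0].
have sL'L : {subset L' <= L} by move=> x /[!inE] /andP [].
have L'e0 x : x \in L' -> x * e = 0 by rewrite inE => /andP [_ /eqP].
have idL' : left_ideal L'.
  apply/left_idealP; split; first by rewrite inE L0 mul0r eqxx.
  move=> a u v L'u L'v.
  rewrite inE mulrDl -mulrA !L'e0 // mulr0 addr0 eqxx andbT.
  by case/left_idealP: idL => _; apply; apply: sL'L.
(* A nonzero [v] in [S0] satisfies [v * e = v], hence lies outside [L']. *)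
have ltL'L : (#|L'| < #|L|)%N.
  apply: proper_card; apply/properP; split; first exact/subsetP.
  have [_ [v S0v nzv] _] := simpleS0.
  exists v; first exact: (subsetP sS0L).
  by apply: contra nzv => /L'e0; rewrite eK // => ->.
have [|n [S [simpleS sSL' decS]]] := IHm L' _ idL'.
  exact: leq_trans ltL'L leLm.
pose S1 (i : 'I_n.+1) : {pred R^o} :=
  if unlift ord0 i is Some j then S j else [in S0].
have S1_0 : S1 ord0 = [in S0] by rewrite /S1 unlift_none.
have S1_lift j : S1 (lift ord0 j) = S j by rewrite /S1 liftK.
have sumS' (w : {ffun 'I_n -> R^o}) :
    (forall i, w i \in S i) -> \sum_i (w i : R) \in L'.
  by move=> Sw; apply: left_ideal_sum => // i; apply: (sSL' i).
exists n.+1, S1; split=> [i | i x | v Lv].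
- by case: (unliftP ord0 i) => [j | ] ->; rewrite (S1_0, S1_lift).
- case: (unliftP ord0 i) => [j | ] ->; rewrite (S1_0, S1_lift).
    by move/sSL'/sL'L.
  exact: (subsetP sS0L).
have S0ve : (v : R) * e \in S0 by apply: left_ideal_mul.
(* Lying in [S0], the element [e] is idempotent, so it kills [v - v * e]. *)
have L'v : (v : R) - v * e \in L'.
  rewrite inE mulrBl -mulrA (eK e) // subrr eqxx andbT.
  rewrite addrC -mulN1r; case/left_idealP: idL => _; apply=> //.
  exact: (subsetP sS0L).
have [w' [[Sw' def_v] uniq_w']] := decS _ L'v.
exists [ffun i => if unlift ord0 i is Some j then w' j else (v : R) * e].
split=> [|w [Sw def_v1]].
  split=> [i | ].
    rewrite ffunE.
    by case: (unliftP ord0 i) => [j | ] ->; rewrite (S1_0, S1_lift).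
  rewrite big_ord_recl ffunE unlift_none -[LHS](subrKC ((v : R) * e)) def_v.
  by congr (_ + _); apply: eq_bigr => i _; rewrite ffunE liftK.
have Sw1 j : [ffun j => w (lift ord0 j)] j \in S j.
  by rewrite ffunE -S1_lift.
rewrite big_ord_recl in def_v1.
have sumE : \sum_(i < n) w (lift ord0 i) = \sum_i [ffun j => w (lift ord0 j)] i.
  by apply: eq_bigr => i _; rewrite ffunE.
(* Uniqueness: right multiplication by [e] kills the components in [L'] and fixes the one in
   [S0]. *)
have w0E : (v : R) * e = w ord0.
  rewrite def_v1 sumE [LHS]mulrDl (L'e0 _ (sumS' _ Sw1)) addr0 eK //.
  by have := Sw ord0; rewrite S1_0.
have w'E : w' = [ffun j => w (lift ord0 j)].
  apply: uniq_w'; split=> //.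
  by rewrite -sumE w0E [in LHS]def_v1 addrAC subrr add0r.
apply/ffunP => i; rewrite ffunE.
by case: (unliftP ord0 i) => [j | ] -> //; rewrite w'E ffunE.
Qed.

Lemma semisimple_of_right_identities : semisimple_ring R.
Proof.
have idT : left_ideal [set: R] by apply/left_idealP; split=> *; rewrite inE.
have [n [S [simpleS _ decS]]] := left_ideal_direct_sum idT.
by exists n, S; split=> // v; apply: decS; rewrite inE.
Qed.

End FiniteRing.

(** * Averaging a projection over the group *)

Section Maschke.
Local Open Scope ring_scope.

Lemma span_submod_closed (F : fieldType) (vT : vectType F) (X : seq vT) :
  GRing.submod_closed ([in X] : {pred vT}) -> {subset <<X>>%VS <= X}.
Proof.
move=> [X0 Xlin] v Xv; rewrite (coord_span (X := in_tuple X) Xv).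
elim/big_ind: _ => [||i _]; first exact: X0.
  by move=> x y Xx Xy; rewrite -[x]scale1r Xlin.
by rewrite -[_ *: _]addr0 Xlin // mem_nth.
Qed.

Variables (gT : finGroupType) (K : finFieldType).
Variables (Theta : gT -> {rmorphism K -> K}) (alpha : gT -> gT -> {unit K}).
Hypotheses (hTheta : hom_to_Aut Theta) (halpha : normalized_cocycle alpha).
Hypothesis (hstab : stabilized_by Theta alpha).

Local Notation tsr := (twisted_skew_ring hTheta halpha hstab).
Local Notation bar := (tsr_bar hTheta halpha hstab).

(** A left ideal is a [K]-subspace because [k *: u = (k *: 1) * u]; it is therefore the span of its
    own elements, onto which [projv] projects. *)
Lemma linear_projection (L : {set tsr}) : left_ideal L ->
  exists2 pi : {linear tsr -> tsr},
    forall x, pi x \in L & forall x, x \in L -> pi x = x.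
Proof.
move=> idL; have [L0 Llin] := left_idealP _ idL.
have clL : GRing.submod_closed ([in enum L] : {pred {ffun gT -> K^o}}).
  split=> [|k u v]; rewrite /= !mem_enum // => Lu Lv.
  have -> : k *: u + v = (k *: 1 : tsr) * (u : tsr) + v.
    by rewrite -tsr_scalerAl mul1r.
  exact: Llin.
pose U := <<(enum L : seq {ffun gT -> K^o})>>%VS.
exists (projv U : {linear {ffun gT -> K^o} -> {ffun gT -> K^o}}).
- move=> x; rewrite -mem_enum.
  by apply: (span_submod_closed clL); apply: memv_proj.
- move=> x Lx; apply: (projv_id (U := U)).
  by apply: memv_span; rewrite mem_enum.
Qed.

(** The two-sided inverse of [bar g]; the scalar cancels the cocycle value in [bar g^-1 * bar g]. *)
Definition bar_inv (g : gT) : tsr := (val (alpha g^-1 g))^-1 *: bar g^-1.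

Lemma cocycle_unit_neq0 g h : val (alpha g h) != 0.
Proof. by rewrite -unitfE; apply: valP. Qed.

(** The cocycle identity at [g], [g^-1], [g], with both outer factors normalized away. *)
Lemma cocycle_inv g : alpha g g^-1 = alpha g^-1 g.
Proof.
have [normal cocA] := halpha; have := cocA g g^-1%g g.
by rewrite mulVg mulgV (normal g).1 (normal g).2 !mul1g => ->.
Qed.

Lemma barE g : bar g = 1 *: bar g.
Proof. by rewrite scale1r. Qed.

Lemma bar_mul g h : bar g * bar h = val (alpha g h) *: bar (g * h)%g.
Proof. by rewrite (barE g) (barE h) tsr_mulZbar rmorph1 !mul1r. Qed.

Lemma bar_scale g k (x : tsr) : bar g * (k *: x) = Theta g k *: (bar g * x).
Proof.
have -> : k *: x = (k *: bar 1%g) * x by rewrite -tsr_scalerAl mul1r.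
rewrite mulrA (barE g) tsr_mulZbar (halpha.1 g).1 mulg1 mulr1 mul1r.
by rewrite -tsr_scalerAl scale1r.
Qed.

Lemma bar_invK g : bar_inv g * bar g = 1.
Proof.
rewrite /bar_inv -tsr_scalerAl bar_mul mulVg scalerA mulVf ?scale1r //.
exact: cocycle_unit_neq0.
Qed.

(** The scalar in [bar_inv g] passes through [bar g] unchanged, as [Theta] fixes the cocycle
    values. *)
Lemma bar_Kinv g : bar g * bar_inv g = 1.
Proof.
rewrite /bar_inv bar_scale bar_mul mulgV fmorphV hstab cocycle_inv.
by rewrite scalerA mulVf ?scale1r // cocycle_unit_neq0.
Qed.

Lemma bar_inv_scale g k x : bar_inv g * (Theta g k *: x) = k *: (bar_inv g * x).
Proof.
rewrite -[x in LHS]mul1r -(bar_Kinv g) -mulrA -bar_scale mulrA bar_invK.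
by rewrite mul1r.
Qed.

(** Inverted form of [bar k * bar h = alpha k h *: bar (k * h)], checked after inserting
    [bar_inv k * bar k]. *)
Lemma bar_mul_bar_inv k h x :
  bar h * (bar_inv (k * h)%g * x) = bar_inv k * (val (alpha k h) *: x).
Proof.
rewrite -[LHS]mul1r -(bar_invK k) -mulrA; congr (_ * _).
by rewrite mulrA bar_mul -tsr_scalerAl mulrA bar_Kinv mul1r.
Qed.

(* Left multiplication by [bar h] permutes the summands up to the cocycle. *)
Lemma average_right_mul (pi : {linear tsr -> tsr}) (x : tsr) :
  x * (\sum_g bar_inv g * pi (bar g)) = \sum_g bar_inv g * pi (bar g * x).
Proof.
rewrite [in LHS](tsr_expand x) mulr_suml.
have rhsE g : pi (bar g * x) = \sum_h pi (bar g * (tsr_coef x h *: bar h)).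
  by rewrite [in LHS](tsr_expand x) mulr_sumr linear_sum.
under [RHS]eq_bigr => g _ do rewrite rhsE mulr_sumr.
rewrite [RHS]exchange_big; apply: eq_bigr => h _ /=.
rewrite -tsr_scalerAl mulr_sumr (reindex_inj (mulIg h)) scaler_sumr.
apply: eq_bigr => g _ /=.
(* Both sides acquire the same factor [alpha g h]; the coefficient of [x] is twisted by [Theta g] on
   its way through [bar g] and untwisted by [bar_inv g]. *)
rewrite bar_mul_bar_inv bar_scale bar_mul !linearZ /=.
by rewrite bar_inv_scale.
Qed.

Lemma mulrn_pchar p (x : tsr) : p \in [pchar K] -> x *+ p = 0.
Proof. by move=> charK; rewrite -scaler_nat (pcharf0 charK) scale0r. Qed.

Lemma left_ideal_right_identity p (L : {set tsr}) :
    p \in [pchar K] -> ~~ (p %| #|[set: gT]|)%N -> left_ideal L ->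
  exists2 e, e \in L & forall x, x \in L -> x * e = x.
Proof.
move=> charK hp idL.
have [pi piL piK] := linear_projection idL.
pose e := \sum_g bar_inv g * pi (bar g).
have eL : e \in L by apply: left_ideal_sum => // g; apply: left_ideal_mul.
have eK x : x \in L -> x * e = x *+ #|[set: gT]|.
  move=> Lx; rewrite average_right_mul //.
  (* Since [bar g * x] stays in [L], [pi] fixes it and each summand is [x]. *)
  rewrite (eq_bigr (fun _ => x)) ?sumr_const ?cardsT // => g _.
  by rewrite piK ?mulrA ?bar_invK ?mul1r //; apply: left_ideal_mul.
(* By Bezout, [m] inverts the group order modulo [p]. An integer multiple [e *+ m] is taken because
   scalars of [K] need not be central, whereas integers are. *)
have [m q def_m _] := egcdnP p (cardG_gt0 [set: gT]%G).
have {}def_m : (m * #|[set: gT]| = q * p + 1)%N.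
  rewrite def_m; congr (_ + _)%N; apply/eqP.
  by rewrite -/(coprime _ _) coprime_sym prime_coprime // (pcharf_prime charK).
exists (e *+ m) => [|x Lx].
  by rewrite -mulr_natl; apply: left_ideal_mul.
rewrite mulrnAr eK // -mulrnA mulnC def_m mulrnDr (mulnC q) mulrnA.
by rewrite (mulrn_pchar _ charK) mul0rn add0r.
Qed.

End Maschke.

Theorem theorem1p7 (gT : finGroupType) (K : finFieldType)
  (Theta : gT -> {rmorphism K -> K}) (alpha : gT -> gT -> {unit K})
  (hTheta : hom_to_Aut Theta)
  (halpha : normalized_cocycle alpha)
  (hstab : stabilized_by Theta alpha)
  (p : nat) (charK : p \in [pchar K]%R) (hp : ~~ (p %| #|[set: gT]|)) :
  semisimple_ring (twisted_skew_ring hTheta halpha hstab).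
Proof.
apply: semisimple_of_right_identities => L.
exact: left_ideal_right_identity charK hp.
Qed.
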